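(* Let $(\mathcal{C},\otimes,k,c)$ be a braided category with unit element $k$, which has enough injectives and satisfies the Künneth formula. Then $\mathrm{Ext}^{\bullet}_{\mathcal{C}}(k,k)$, with the Yoneda product, is graded commutative; that is, $f\smile g=(-1)^{pq}\,g\smile f$ for all $f\in \mathrm{Ext}^p_{\mathcal{C}}(k,k)$ and $g\in \mathrm{Ext}^q_{\mathcal{C}}(k,k)$.
   Context: A braided category with unit element $k$ is a tuple $(\mathcal{C},\otimes,k,c)$ such that: (1) $\mathcal{C}$ is an abelian category. (2) $-\otimes-$ is a bifunctor on $\mathcal{C}$, bilinear and associative, and there are natural isomorphisms $k\otimes X\cong X\cong X\otimes k$ for all objects $X$ of $\mathcal{C}$. (3) For every pair of objects $X,Y$, $c_{X,Y}:X\otimes Y\to Y\otimes X$ is a natural isomorphism; the isomorphism $c_{X,k}:X\otimes k\cong k\otimes X$ agrees with the isomorphism coming from the unit axiom; and for all objects $X,Y,Z$ the Yang-Baxter equation holds: $$(\mathrm{id}_Z\otimes c_{X,Y})\circ(c_{X,Z}\otimes \mathrm{id}_Y)\circ(\mathrm{id}_X\otimes c_{Y,Z})=(c_{Y,Z}\otimes \mathrm{id}_X)\circ(\mathrm{id}_Y\otimes c_{X,Z})\circ(c_{X,Y}\otimes\mathrm{id}_Z).$$ If only the data and axioms (1) and (2) are given, $(\mathcal{C},\otimes,k)$ is called a monoidal category. A monoidal category $(\mathcal{C},\otimes,k)$ satisfies the Künneth formula if there are natural isomorphisms $H_*(X_*,d_X)\otimes H_*(Y_*,d_Y)\cong H_*(X_*\otimes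 Y_*,d_{X\otimes Y})$ for all pairs of complexes $(X_*,d_X)$, $(Y_*,d_Y)$ in $\mathcal{C}$, where $X_*\otimes Y_*$ denotes the usual total tensor product complex. $\smile$ denotes the Yoneda product on $\mathrm{Ext}^{\bullet}_{\mathcal{C}}(k,k)$. *)

(* Defs.v *)
From HB Require Import structures.
From mathcomp Require Import all_boot all_order all_algebra.
From mathcomp Require Import boolp.

Set Implicit Arguments.
Unset Strict Implicit.
Unset Printing Implicit Defensive.

Import GRing.Theory.
Local Open Scope ring_scope.

Record preadditive := Preadditive {
  obj :> Type;
  hom : obj -> obj -> zmodType;
  idm : forall A, hom A A;
  comp : forall A B C, hom B C -> hom A B -> hom A C;
  comp1m : forall A B (f : hom A B), comp (idm B) f = f;
  compm1 : forall A B (f : hom A B), comp f (idm A) = f;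
  compA : forall A B C D (h : hom C D) (g : hom B C) (f : hom A B),
    comp h (comp g f) = comp (comp h g) f;
  compDl : forall A B C (g g' : hom B C) (f : hom A B),
    comp (g + g') f = comp g f + comp g' f;
  compDr : forall A B C (g : hom B C) (f f' : hom A B),
    comp g (f + f') = comp g f + comp g f' }.

Arguments hom {p}.
Arguments idm {p}.
Arguments comp {p A B C}.

Declare Scope cat_scope.
Delimit Scope cat_scope with cat.
Notation "g ∘ f" := (comp g f) (at level 40, left associativity) : cat_scope.
Local Open Scope cat_scope.

Section Morphisms.
Variable C : preadditive.
Implicit Types A B : C.

Definition is_iso A B (f : hom A B) : Prop :=
  exists g : hom B A, g ∘ f = idm A /\ f ∘ g = idm B.

Definition mono A B (f : hom A B) : Prop :=
  forall W (u v : hom W A), f ∘ u = f ∘ v -> u = v.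

Definition epi A B (f : hom A B) : Prop :=
  forall W (u v : hom B W), u ∘ f = v ∘ f -> u = v.

Definition is_kernel A B (f : hom A B) K (i : hom K A) : Prop :=
  f ∘ i = 0 /\
  forall W (h : hom W A), f ∘ h = 0 -> exists! u : hom W K, i ∘ u = h.

Definition is_cokernel A B (f : hom A B) Q (q : hom B Q) : Prop :=
  q ∘ f = 0 /\
  forall W (h : hom B W), h ∘ f = 0 -> exists! u : hom Q W, u ∘ q = h.

Definition injective_object (J : C) : Prop :=
  forall A B (m : hom A B) (f : hom A J), mono m ->
  exists g : hom B J, g ∘ m = f.

Definition enough_injectives : Prop :=
  forall A, exists (J : C) (m : hom A J), injective_object J /\ mono m.

End Morphisms.

Record abelian := Abelian {
  abelian_preadditive :> preadditive;
  zero_obj : abelian_preadditive;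
  zero_initial : forall A (f : hom zero_obj A), f = 0;
  zero_terminal : forall A (f : hom A zero_obj), f = 0;
  biprod : forall A B : abelian_preadditive, exists (S : abelian_preadditive)
    (i1 : hom A S) (i2 : hom B S) (p1 : hom S A) (p2 : hom S B),
    [/\ p1 ∘ i1 = idm A, p2 ∘ i2 = idm B, p1 ∘ i2 = 0, p2 ∘ i1 = 0
      & i1 ∘ p1 + i2 ∘ p2 = idm S];
  ker : forall (A B : abelian_preadditive), hom A B -> abelian_preadditive;
  kerm : forall A B (f : hom A B), hom (ker f) A;
  kermP : forall A B (f : hom A B), is_kernel f (kerm f);
  coker : forall (A B : abelian_preadditive), hom A B -> abelian_preadditive;
  cokerm : forall A B (f : hom A B), hom B (coker f);
  cokermP : forall A B (f : hom A B), is_cokernel f (cokerm f);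
  mono_normal : forall (A B : abelian_preadditive) (m : hom A B), mono m ->
    exists (D : abelian_preadditive) (g : hom B D), is_kernel g m;
  epi_normal : forall (A B : abelian_preadditive) (e : hom A B), epi e ->
    exists (D : abelian_preadditive) (g : hom D A), is_cokernel g e }.

Arguments ker {a A B}.
Arguments kerm {a A B}.
Arguments coker {a A B}.
Arguments cokerm {a A B}.

Section PreadditiveTheory.
Variable C : preadditive.
Implicit Types A B D : C.

Lemma comp0m A B D (f : hom A B) : (0 : hom B D) ∘ f = 0.
Proof. by apply: (addrI (0 ∘ f)); rewrite -compDl !addr0. Qed.

Lemma compm0 A B D (g : hom B D) : g ∘ (0 : hom A B) = 0.
Proof. by apply: (addrI (g ∘ 0)); rewrite -compDr !addr0. Qed.

Lemma compNl A B D (g : hom B D) (f : hom A B) : (- g) ∘ f = - (g ∘ f).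
Proof. by apply: (addrI (g ∘ f)); rewrite -compDl !subrr comp0m. Qed.

Lemma compNr A B D (g : hom B D) (f : hom A B) : g ∘ (- f) = - (g ∘ f).
Proof. by apply: (addrI (g ∘ f)); rewrite -compDr !subrr compm0. Qed.

Lemma compBl A B D (g g' : hom B D) (f : hom A B) :
  (g - g') ∘ f = g ∘ f - g' ∘ f.
Proof. by rewrite compDl compNl. Qed.

Lemma compBr A B D (g : hom B D) (f f' : hom A B) :
  g ∘ (f - f') = g ∘ f - g ∘ f'.
Proof. by rewrite compDr compNr. Qed.

End PreadditiveTheory.

Section AbelianTheory.
Variable C : abelian.
Implicit Types A B D : C.

Definition ker_lift A B (f : hom A B) W (h : hom W A) (fh : f ∘ h = 0) :
  hom W (ker f) := sval (cid ((kermP f).2 W h fh)).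

Lemma ker_liftE A B (f : hom A B) W (h : hom W A) (fh : f ∘ h = 0) :
  kerm f ∘ ker_lift fh = h.
Proof. by rewrite /ker_lift; case: cid => u []. Qed.

Definition coker_desc A B (f : hom A B) W (h : hom B W) (hf : h ∘ f = 0) :
  hom (coker f) W := sval (cid ((cokermP f).2 W h hf)).

Lemma coker_descE A B (f : hom A B) W (h : hom B W) (hf : h ∘ f = 0) :
  coker_desc hf ∘ cokerm f = h.
Proof. by rewrite /coker_desc; case: cid => u []. Qed.

Lemma kerm_comp A B (f : hom A B) : f ∘ kerm f = 0.
Proof. by case: (kermP f). Qed.

Lemma comp_cokerm A B (f : hom A B) : cokerm f ∘ f = 0.
Proof. by case: (cokermP f). Qed.

Lemma kernel_mono A B (f : hom A B) K (i : hom K A) : is_kernel f i -> mono i.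
Proof.
move=> [fi0 iU] W u v iuv; have [|w [_ wU]] := iU W (i ∘ u).
  by rewrite compA fi0 comp0m.
by rewrite -(wU u erefl) (wU v).
Qed.

Lemma cokernel_epi A B (f : hom A B) Q (q : hom B Q) : is_cokernel f q -> epi q.
Proof.
move=> [qf0 qU] W u v uvq; have [|w [_ wU]] := qU W (u ∘ q).
  by rewrite -compA qf0 compm0.
by rewrite -(wU u erefl) (wU v).
Qed.

Lemma mono0 A B (m : hom A B) :
  (forall W (x : hom W A), m ∘ x = 0 -> x = 0) -> mono m.
Proof.
move=> m0 W u v muv; apply/eqP; rewrite -subr_eq0; apply/eqP.
by apply: m0; rewrite compBr muv subrr.
Qed.

Lemma monoV A B (m : hom A B) W (x : hom W A) : mono m -> m ∘ x = 0 -> x = 0.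
Proof. by move=> mm mx; apply: mm; rewrite mx compm0. Qed.

Lemma epiV A B (e : hom A B) W (x : hom B W) : epi e -> x ∘ e = 0 -> x = 0.
Proof. by move=> me ex; apply: me; rewrite ex comp0m. Qed.

Lemma epi_comp A B D (e : hom A B) (e' : hom B D) :
  epi e -> epi e' -> epi (e' ∘ e).
Proof. by move=> he he' W u v; rewrite !compA => /he /he'. Qed.

Definition is_exact A B D (f : hom A B) (g : hom B D) : Prop :=
  is_kernel g (kerm (cokerm f)).

Lemma exact_comp A B D (f : hom A B) (g : hom B D) :
  is_exact f g -> g ∘ f = 0.
Proof.
move=> [gk _]; have f0 := comp_cokerm f.
by rewrite -(ker_liftE f0) compA gk comp0m.
Qed.

Lemma exact_kernel A B D K (i : hom K B) (f : hom A B) (g : hom B D) :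
  is_kernel g i -> g ∘ f = 0 -> cokerm f ∘ i = 0 -> is_exact f g.
Proof.
move=> [gi0 iU] gf0 fi0.
have gk : g ∘ kerm (cokerm f) = 0.
  by rewrite -(coker_descE gf0) -compA kerm_comp compm0.
split=> // W h gh; have [u [iu _]] := iU W h gh.
have fh : cokerm f ∘ h = 0 by rewrite -iu compA fi0 comp0m.
exists (ker_lift fh); split=> [|v kv]; first exact: ker_liftE.
by apply: (kernel_mono (kermP _)); rewrite ker_liftE.
Qed.

Lemma coimage_mono A B (g : hom A B) : mono (coker_desc (kerm_comp g)).
Proof.
set e := cokerm (kerm g); set m := coker_desc _.
have me : m ∘ e = g by exact: coker_descE.
apply: mono0 => W x mx0.
pose q := cokerm x; pose n := coker_desc mx0.
have nq : n ∘ q = m by exact: coker_descE.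
have /epi_normal[D [h hC]] : epi (q ∘ e).
  by apply: epi_comp; apply: cokernel_epi (cokermP _).
have gh0 : g ∘ h = 0.
  by rewrite -me -nq -!compA (compA q) hC.1 compm0.
have eh0 : e ∘ h = 0 by rewrite -(ker_liftE gh0) compA comp_cokerm comp0m.
have [t [te _]] := hC.2 _ e eh0.
have tq : t ∘ q = idm _.
  by apply: (cokernel_epi (cokermP (kerm g))); rewrite comp1m -compA te.
by rewrite -(comp1m x) -tq -compA comp_cokerm compm0.
Qed.

Lemma exact_coker_mono A B D (f : hom A B) (g : hom B D) (gf0 : g ∘ f = 0) :
  is_exact f g -> mono (coker_desc gf0).
Proof.
move=> fg; apply: mono0 => W x gx0.
set m := coker_desc _ in gx0.
have mE : m ∘ cokerm f = g by exact: coker_descE.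
have kg : cokerm f ∘ kerm g = 0.
  have [u [ku _]] := fg.2 _ _ (kerm_comp g).
  by rewrite -ku compA kerm_comp comp0m.
have ef : cokerm (kerm g) ∘ f = 0.
  by rewrite -(ker_liftE gf0) compA comp_cokerm comp0m.
pose s := coker_desc ef; pose r := coker_desc kg.
have sf : s ∘ cokerm f = cokerm (kerm g) by exact: coker_descE.
have rg : r ∘ cokerm (kerm g) = cokerm f by exact: coker_descE.
have rs : r ∘ s = idm _.
  apply: (cokernel_epi (cokermP f)).
  by rewrite comp1m -compA sf rg.
have ms : m = coker_desc (kerm_comp g) ∘ s.
  apply: (cokernel_epi (cokermP f)).
  by rewrite mE -compA sf coker_descE.
have sx0 : s ∘ x = 0.
  by apply: (monoV (@coimage_mono _ _ g)); rewrite compA -ms.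
by rewrite -(comp1m x) -rs -compA sx0 compm0.
Qed.

Lemma injective_extend A B D (f : hom A B) (g : hom B D) (J : C)
    (h : hom B J) :
  injective_object J -> is_exact f g -> h ∘ f = 0 ->
  exists t : hom D J, t ∘ g = h.
Proof.
move=> injJ fg hf0; have gf0 := exact_comp fg.
have [t tE] := injJ _ _ _ (coker_desc hf0) (@exact_coker_mono _ _ _ f g gf0 fg).
by exists t; rewrite -(coker_descE gf0) compA tE coker_descE.
Qed.

End AbelianTheory.

Record injective_resolution (C : abelian) (A : C) := InjectiveResolution {
  res :> nat -> C;
  res_d : forall n, hom (res n) (res n.+1);
  res_eta : hom A (res 0);
  res_inj : forall n, injective_object (res n);
  res_ker : is_kernel (res_d 0) res_eta;
  res_exact : forall n, is_exact (res_d n) (res_d n.+1) }.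

Arguments res_d {C A}.
Arguments res_eta {C A}.

Section ChosenResolution.
Variables (C : abelian) (hI : enough_injectives C).

Lemma enough_injectives_sig (A : C) :
  {J : C & {m : hom A J | injective_object J /\ mono m}}.
Proof. by have [J /cid H] := cid (hI A); exists J. Qed.

Definition inj_hull A : C := projT1 (enough_injectives_sig A).
Definition inj_emb A : hom A (inj_hull A) :=
  sval (projT2 (enough_injectives_sig A)).

Lemma inj_hullP A : injective_object (inj_hull A).
Proof. by case: (svalP (projT2 (enough_injectives_sig A))). Qed.

Lemma inj_embP A : mono (inj_emb A).
Proof. by case: (svalP (projT2 (enough_injectives_sig A))). Qed.

Variable A : C.

Record arrow := Arrow { src : C; tgt : C; arr : hom src tgt }.

Fixpoint injres_arrow (n : nat) : arrow :=
  if n is m.+1 then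
    let f := arr (injres_arrow m) in Arrow (inj_emb (coker f) ∘ cokerm f)
  else Arrow (inj_emb A).

Definition injres_obj n : C := tgt (injres_arrow n).
Definition injres_d n : hom (injres_obj n) (injres_obj n.+1) :=
  arr (injres_arrow n.+1).

Lemma injres_inj n : injective_object (injres_obj n).
Proof. by case: n => [|n]; apply: inj_hullP. Qed.

Lemma injres_step (X Y : C) (f : hom X Y) :
  is_exact f (inj_emb (coker f) ∘ cokerm f).
Proof.
split=> [|W h mh0]; first by rewrite -compA kerm_comp compm0.
have fh : cokerm f ∘ h = 0.
  by apply: (monoV (@inj_embP (coker f))); rewrite compA.
exact: (kermP (cokerm f)).2.
Qed.

Lemma injres_ker : is_kernel (injres_d 0) (inj_emb A).
Proof.
split=> [|W h]; first by rewrite /injres_d /= -compA comp_cokerm compm0.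
move=> /((injres_step (inj_emb A)).2 W h)[u [ku _]].
have [D [g gk]] := mono_normal (@inj_embP A).
apply: gk.2; rewrite -ku compA.
have gA : g ∘ inj_emb A = 0 by case: gk.
by rewrite -(coker_descE gA) -(compA _ (cokerm _)) kerm_comp compm0 comp0m.
Qed.

Definition injres : injective_resolution A :=
  InjectiveResolution injres_inj injres_ker
    (fun n => injres_step (arr (injres_arrow n.+1))).

End ChosenResolution.

Section Cohomology.
Variables (C : abelian) (A B : C) (J : injective_resolution B) (n : nat).

Definition cocycle_pred : {pred hom A (J n)} :=
  fun f => res_d J n ∘ f == 0.

Lemma cocycle_zmod_closed : zmod_closed cocycle_pred.
Proof.
split=> [|f g]; rewrite !unfold_in ?compm0 // => /eqP f0 /eqP g0.
by rewrite compBr f0 g0 subrr.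
Qed.
HB.instance Definition _ :=
  GRing.isZmodClosed.Build (hom A (J n)) cocycle_pred cocycle_zmod_closed.

Record cocycle := Cocycle {
  cocycle_val :> hom A (J n);
  cocycle_valP : cocycle_val \in cocycle_pred }.
HB.instance Definition _ := [isSub for cocycle_val].
HB.instance Definition _ := [Choice of cocycle by <:].
HB.instance Definition _ := [SubChoice_isSubZmodule of cocycle by <:].

Lemma cocycleP (f : cocycle) : res_d J n ∘ f = 0.
Proof. by apply/eqP; have := cocycle_valP f; rewrite unfold_in. Qed.

Definition mk_cocycle (f : hom A (J n)) (df0 : res_d J n ∘ f = 0) : cocycle :=
  Cocycle (introT eqP df0 : f \in cocycle_pred).

End Cohomology.

Definition is_coboundary (C : abelian) (A B : C) (J : injective_resolution B)
    (n : nat) : hom A (J n) -> Prop :=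
  if n is m.+1 then fun f => exists h : hom A (J m), f = res_d J m ∘ h
  else fun f => f = 0.

Section Coboundaries.
Variables (C : abelian) (A B : C) (J : injective_resolution B) (n : nat).

Definition coboundary_pred : {pred cocycle A J n} :=
  fun f => `[< is_coboundary (cocycle_val f) >].

Lemma coboundary_zmod_closed : zmod_closed coboundary_pred.
Proof.
rewrite /coboundary_pred; split=> [|f g]; rewrite !unfold_in.
  by apply/asboolP; case: n => //= m; exists 0; rewrite compm0.
move=> /asboolP f0 /asboolP g0; apply/asboolP.
have -> : cocycle_val (f - g) = cocycle_val f - cocycle_val g by [].
move: (cocycle_val f) (cocycle_val g) f0 g0.
case: n => [|m] /= u v; first by move=> -> ->; rewrite subr0.
by move=> [h ->] [k ->]; exists (h - k); rewrite compBr.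
Qed.
HB.instance Definition _ :=
  GRing.isZmodClosed.Build (cocycle A J n) coboundary_pred
    coboundary_zmod_closed.

Definition Hn : zmodType := Quotient.quot coboundary_pred.

Definition class (f : cocycle A J n) : Hn := (\pi_Hn f)%qT.

Lemma class_eq (f g : cocycle A J n) :
  class f = class g <-> is_coboundary (cocycle_val f - cocycle_val g).
Proof.
split=> [/eqP|fg]; last apply/eqP.
  by rewrite -Quotient.idealrBE unfold_in => /asboolP.
by rewrite -Quotient.idealrBE unfold_in; apply/asboolP.
Qed.

End Coboundaries.

Section Lifting.
Variables (C : abelian) (B D : C).
Variables (I : injective_resolution B) (J : injective_resolution D) (p : nat).

Definition is_chain_lift (f : hom B (J p)) (F : forall n, hom (I n) (J (n + p)%N)) :=
  F 0%N ∘ res_eta I = f /\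
  forall n, F n.+1 ∘ res_d I n = res_d J (n + p) ∘ F n.

Lemma res_dd n : res_d J n.+1 ∘ res_d J n = 0.
Proof. exact: exact_comp (res_exact J n). Qed.

Lemma res_eta_exact : is_exact (res_eta I) (res_d I 0).
Proof.
apply: (exact_kernel (res_ker I)); first by case: (res_ker I).
exact: comp_cokerm.
Qed.

Let ok (n : nat) : hom (I n) (J (n + p)%N) -> Prop :=
  match n return hom (I n) (J (n + p)%N) -> Prop with
  | 0 => fun u => res_d J p ∘ (u ∘ res_eta I) = 0
  | m.+1 => fun u => res_d J (m.+1 + p) ∘ (u ∘ res_d I m) = 0
  end.

Lemma lift_step n (u : hom (I n) (J (n + p)%N)) : ok u ->
  exists v : hom (I n.+1) (J (n.+1 + p)%N),
    v ∘ res_d I n = res_d J (n + p) ∘ u /\ ok v.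
Proof.
move=> oku.
have [v vE] : exists v : hom (I n.+1) (J (n.+1 + p)%N),
    v ∘ res_d I n = res_d J (n + p) ∘ u.
  case: n u oku => [|n] u /= oku.
    by apply: injective_extend res_eta_exact _; rewrite -?compA ?oku //;
      apply: res_inj.
  by apply: injective_extend (res_exact I n) _; rewrite -?compA ?oku //;
    apply: res_inj.
by exists v; split=> //=; rewrite vE compA res_dd comp0m.
Qed.

Lemma chain_lift_exists (f : hom B (J p)) : res_d J p ∘ f = 0 ->
  exists F, is_chain_lift f F.
Proof.
move=> df0.
have [u0 u0E] : exists u : hom (I 0) (J p), u ∘ res_eta I = f.
  by apply: res_inj; apply: kernel_mono (res_ker I).
have ok0 : @ok 0 u0 by rewrite /= u0E.
pose next n (s : {u : hom (I n) (J (n + p)%N) | ok u}) :=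
  cid (lift_step (proj2_sig s)).
pose S := fix S n : {u : hom (I n) (J (n + p)%N) | ok u} :=
  if n is m.+1 then
    exist _ (sval (next m (S m))) (proj2 (proj2_sig (next m (S m))))
  else exist _ u0 ok0.
exists (fun n => sval (S n)); split=> // n.
exact: proj1 (proj2_sig (next n (S n))).
Qed.

Definition chain_lift (f : hom B (J p)) (df0 : res_d J p ∘ f = 0) :
  forall n, hom (I n) (J (n + p)%N) := sval (cid (chain_lift_exists df0)).

Lemma chain_liftP (f : hom B (J p)) (df0 : res_d J p ∘ f = 0) :
  is_chain_lift f (chain_lift df0).
Proof. exact: svalP (cid (chain_lift_exists df0)). Qed.

Lemma chain_lift_cocycle (A : C) (f : hom B (J p))
    (F : forall n, hom (I n) (J (n + p)%N)) q (g : hom A (I q)) :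
  is_chain_lift f F -> res_d I q ∘ g = 0 -> res_d J (q + p) ∘ (F q ∘ g) = 0.
Proof. by move=> [_ dF] dg0; rewrite compA -dF -compA dg0 compm0. Qed.

End Lifting.

Section CoboundaryTheory.
Variables (C : abelian) (D : C) (J : injective_resolution D).

Lemma coboundary_comp (A B : C) n (f : hom B (J n)) (g : hom A B) :
  is_coboundary f -> is_coboundary (f ∘ g).
Proof.
case: n f => [|n] f /= => [->|[h ->]]; first by rewrite comp0m.
by exists (h ∘ g); rewrite compA.
Qed.

Lemma coboundary_cocycle (B : C) n (f : hom B (J n)) :
  is_coboundary f -> res_d J n ∘ f = 0.
Proof.
case: n f => [|n] f /= => [->|[h ->]]; first by rewrite compm0.
by rewrite compA res_dd comp0m.
Qed.

Lemma coboundaryD (B : C) n (f g : hom B (J n)) :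
  is_coboundary f -> is_coboundary g -> is_coboundary (f + g).
Proof.
case: n f g => [|n] f g /= => [-> ->|[h ->] [k ->]]; first by rewrite addr0.
by exists (h + k); rewrite compDr.
Qed.

Lemma coboundary_post (A B : C) (I : injective_resolution B) p
    (F : forall n, hom (I n) (J (n + p)%N)) q (x : hom A (I q)) :
  (forall n, F n.+1 ∘ res_d I n = res_d J (n + p) ∘ F n) ->
  is_coboundary x -> is_coboundary (F q ∘ x).
Proof.
move=> dF; case: q x => [|q] x /= => [->|[h ->]].
  by rewrite compm0; case: p F dF => //= m F dF; exists 0; rewrite compm0.
by exists (F q ∘ h); rewrite !compA dF.
Qed.

Lemma chain_lift_null (A B : C) (I : injective_resolution B) p
    (F : forall n, hom (I n) (J (n + p)%N)) (f : hom B (J p)) q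
    (g : hom A (I q)) :
  is_chain_lift f F -> is_coboundary f -> res_d I q ∘ g = 0 ->
  is_coboundary (F q ∘ g).
Proof.
move=> [F0 dF] f0 dg0.
suff [a [b [FE b0]]] : exists (a : hom (I q.+1) (J (q + p)%N))
    (b : hom (I q) (J (q + p)%N)),
    F q = a ∘ res_d I q + b /\ is_coboundary b.
  by rewrite FE compDl -compA dg0 compm0 add0r; apply: coboundary_comp.
elim: q {g dg0} => [|q [a [b [FE b0]]]].
  have [b [b0 bE]] : exists b : hom (I 0) (J p),
      is_coboundary b /\ b ∘ res_eta I = f.
    case: p F f F0 dF f0 => [|m] F f F0 dF /=.
      by move=> ->; exists 0; rewrite comp0m.
    move=> [h ->].
    have [k kE] := @res_inj _ _ J m _ _ _ h (kernel_mono (res_ker I)).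
    by exists (res_d J m ∘ k); split; [exists k | rewrite -compA kE].
  have [|a aE] := injective_extend (h := F 0%N - b) (@res_inj _ _ J _)
    (res_eta_exact I).
    by rewrite compBl F0 bE subrr.
  by exists a, b; rewrite aE subrK.
have [|c cE] := injective_extend (h := F q.+1 - res_d J (q + p) ∘ a)
    (@res_inj _ _ J _) (res_exact I q).
  rewrite compBl dF FE compDr (coboundary_cocycle b0) addr0 compA.
  by rewrite subrr.
by exists c, (res_d J (q + p) ∘ a); rewrite cE subrK; split=> //; exists a.
Qed.

End CoboundaryTheory.

Section Ext.
Variables (C : abelian) (hI : enough_injectives C).

Definition Ext (n : nat) (A B : C) : zmodType := Hn A (injres hI B) n.

Definition ext_cast (A B : C) m n (e : m = n) (x : Ext m A B) : Ext n A B :=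
  ecast i (Ext i A B) e x.

(* Ext^p(B,D) x Ext^q(A,B) -> Ext^(p+q)(A,D): a cocycle B -> J^p representing
   the first class is lifted to a chain map I -> J[p] between the resolutions
   of B and D, which is then composed with a cocycle A -> I^q representing the
   second.  Independence of all choices is [yoneda_class]. *)
Definition yoneda (A B D : C) p q (f : Ext p B D) (g : Ext q A B) :
    Ext (p + q) A D :=
  let f0 : cocycle B (injres hI D) p := repr f in
  let g0 : cocycle A (injres hI B) q := repr g in
  let F := chain_lift (injres hI B) (cocycleP f0) in
  ext_cast (addnC q p)
    (class (mk_cocycle (chain_lift_cocycle (chain_liftP _ (cocycleP f0))
                                           (cocycleP g0)))).

Lemma yoneda_class (A B D : C) p q (f : cocycle B (injres hI D) p)
    (g : cocycle A (injres hI B) q)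
    (F : forall n, hom (injres hI B n) (injres hI D (n + p)%N))
    (Ff : is_chain_lift f F) :
  yoneda (class f : Ext p B D) (class g : Ext q A B) =
  ext_cast (addnC q p)
    (class (mk_cocycle (chain_lift_cocycle Ff (cocycleP g)))).
Proof.
rewrite /yoneda; congr (ext_cast _ _); apply/class_eq => /=.
set f0 := (repr _ : cocycle _ _ p); set g0 := (repr _ : cocycle _ _ q).
have f0E : class f0 = class f by exact: reprK.
have g0E : class g0 = class g by exact: reprK.
move/class_eq: f0E => f0E; move/class_eq: g0E => g0E.
set F0 := chain_lift _ _.
have [F0f dF0] : is_chain_lift f0 F0 by exact: chain_liftP.
have -> : F0 q ∘ g0 - F q ∘ g = (F0 q - F q) ∘ g0 + F q ∘ (g0 - g : hom _ _).
  by rewrite compBl compBr addrA subrK.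
case: Ff => [Ff dF]; apply: coboundaryD; last exact: coboundary_post.
apply: (chain_lift_null (F := fun n => F0 n - F n)) f0E (cocycleP g0).
by split=> [|n]; rewrite compBl ?F0f ?Ff // dF0 dF compBr.
Qed.

End Ext.

Arguments yoneda {C hI A B D p q}.
Arguments ext_cast {C hI A B m n}.

(* Complexes are homological and graded by all of int; the differential is
   indexed by source and target, and vanishes unless it lowers the degree by
   one, so that no transport between X_(n+1-1) and X_n is needed. *)
Record complex (C : preadditive) := Complex {
  cx :> int -> C;
  cx_d : forall i j, hom (cx i) (cx j);
  cx_shape : forall i j, i != j + 1 -> cx_d i j = 0;
  cx_dd : forall i j l, cx_d j l ∘ cx_d i j = 0 }.

Arguments cx_d {C}.

Record chain_map (C : preadditive) (X Y : complex C) := ChainMap {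
  cm :> forall n, hom (X n) (Y n);
  cm_d : forall i j, cm j ∘ cx_d X i j = cx_d Y i j ∘ cm i }.

Section Homology.
Variable C : abelian.
Implicit Types X Y : complex C.

Definition cycles X n : C := ker (cx_d X n (n - 1)).

Definition boundaries X n : hom (X (n + 1)) (cycles X n) :=
  ker_lift (cx_dd X (n + 1) n (n - 1)).

Definition homology X n : C := coker (boundaries X n).

Section Map.
Variables (X Y : complex C) (f : chain_map X Y) (n : int).

Lemma cycles_map_subproof :
  cx_d Y n (n - 1) ∘ (f n ∘ kerm (cx_d X n (n - 1))) = 0.
Proof. by rewrite compA -cm_d -compA kerm_comp compm0. Qed.

Definition cycles_map : hom (cycles X n) (cycles Y n) :=
  ker_lift cycles_map_subproof.

Lemma homology_map_subproof :
  (cokerm (boundaries Y n) ∘ cycles_map) ∘ boundaries X n = 0.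
Proof.
suff E : cycles_map ∘ boundaries X n = boundaries Y n ∘ f (n + 1).
  by rewrite -compA E compA comp_cokerm comp0m.
apply: (kernel_mono (kermP _)).
by rewrite !compA !ker_liftE -compA ker_liftE cm_d.
Qed.

Definition homology_map : hom (homology X n) (homology Y n) :=
  coker_desc homology_map_subproof.

End Map.
End Homology.

(* The unit comes with natural isomorphisms only; the triangle identity between
   [assoc], [lunit] and [runit] is not assumed. *)
Record monoidal := Monoidal {
  monoidal_abelian :> abelian;
  unit_obj : monoidal_abelian;
  ten : monoidal_abelian -> monoidal_abelian -> monoidal_abelian;
  tenm : forall A A' B B' : monoidal_abelian,
    hom A A' -> hom B B' -> hom (ten A B) (ten A' B');
  tenm1 : forall A B, tenm (idm A) (idm B) = idm (ten A B);
  tenm_comp : forall (A A' A'' B B' B'' : monoidal_abelian)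
    (f : hom A A') (f' : hom A' A'') (g : hom B B') (g' : hom B' B''),
    tenm (f' ∘ f) (g' ∘ g) = tenm f' g' ∘ tenm f g;
  tenmDl : forall (A A' B B' : monoidal_abelian)
    (f f' : hom A A') (g : hom B B'), tenm (f + f') g = tenm f g + tenm f' g;
  tenmDr : forall (A A' B B' : monoidal_abelian)
    (f : hom A A') (g g' : hom B B'), tenm f (g + g') = tenm f g + tenm f g';
  assoc : forall A B D, hom (ten (ten A B) D) (ten A (ten B D));
  assocV : forall A B D, hom (ten A (ten B D)) (ten (ten A B) D);
  assocK : forall A B D, assocV A B D ∘ assoc A B D = idm _;
  assocVK : forall A B D, assoc A B D ∘ assocV A B D = idm _;
  assoc_nat : forall (A A' B B' D D' : monoidal_abelian)
    (f : hom A A') (g : hom B B') (h : hom D D'),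
    assoc A' B' D' ∘ tenm (tenm f g) h = tenm f (tenm g h) ∘ assoc A B D;
  pentagon : forall A B D E,
    assoc A B (ten D E) ∘ assoc (ten A B) D E =
    tenm (idm A) (assoc B D E) ∘ assoc A (ten B D) E
      ∘ tenm (assoc A B D) (idm E);
  lunit : forall A, hom (ten unit_obj A) A;
  runit : forall A, hom (ten A unit_obj) A;
  lunit_iso : forall A, is_iso (lunit A);
  runit_iso : forall A, is_iso (runit A);
  lunit_nat : forall (A B : monoidal_abelian) (f : hom A B),
    lunit B ∘ tenm (idm unit_obj) f = f ∘ lunit A;
  runit_nat : forall (A B : monoidal_abelian) (f : hom A B),
    runit B ∘ tenm f (idm unit_obj) = f ∘ runit A }.

Arguments unit_obj {m}.
Arguments ten {m}.
Arguments tenm {m A A' B B'}.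
Arguments assoc {m}.
Arguments assocV {m}.
Arguments lunit {m}.
Arguments runit {m}.

Notation "A ⊗ B" := (ten A B) (at level 40, left associativity) : cat_scope.
Notation "f ⊠ g" := (tenm f g) (at level 35, right associativity) : cat_scope.

(* The Yang-Baxter equation is an equality of morphisms from X ⊗ (Y ⊗ Z) to
   Z ⊗ (Y ⊗ X), with the associators made explicit. *)
Record braided := Braided {
  braided_monoidal :> monoidal;
  braid : forall X Y : braided_monoidal, hom (X ⊗ Y) (Y ⊗ X);
  braid_iso : forall X Y, is_iso (braid X Y);
  braid_nat : forall (X X' Y Y' : braided_monoidal)
    (f : hom X X') (g : hom Y Y'),
    braid X' Y' ∘ (f ⊠ g) = (g ⊠ f) ∘ braid X Y;
  braid_unit : forall X, lunit X ∘ braid X unit_obj = runit X;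
  yang_baxter : forall X Y Z,
    (idm Z ⊠ braid X Y) ∘ assoc Z X Y ∘ (braid X Z ⊠ idm Y)
      ∘ assocV X Z Y ∘ (idm X ⊠ braid Y Z) =
    assoc Z Y X ∘ (braid Y Z ⊠ idm X) ∘ assocV Y Z X
      ∘ (idm Y ⊠ braid X Z) ∘ assoc Y X Z ∘ (braid X Y ⊠ idm Z)
      ∘ assocV X Y Z }.

Section Kunneth.
Variable M : monoidal.

(* [T n], with the maps [inj], is the coproduct of all V_i ⊗ W_j, i + j = n.
   Such coproducts are infinite in general and need not exist in M. *)
Definition is_graded_tensor (V W T : int -> M)
    (inj : forall i j n, i + j = n -> hom (V i ⊗ W j) (T n)) : Prop :=
  forall n (Z : M) (phi : forall i j, i + j = n -> hom (V i ⊗ W j) Z),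
  exists! u : hom (T n) Z, forall i j (e : i + j = n), u ∘ inj i j n e = phi i j e.

Record graded_tensor (V W : int -> M) := GradedTensor {
  gt :> int -> M;
  gt_inj : forall i j n, i + j = n -> hom (V i ⊗ W j) (gt n);
  gt_coprod : is_graded_tensor gt_inj }.

Record total_tensor (X Y : complex M) := TotalTensor {
  tt_cx :> complex M;
  tt_inj : forall i j n, i + j = n -> hom (X i ⊗ Y j) (tt_cx n);
  tt_coprod : is_graded_tensor tt_inj;
  tt_d : forall i j n (e : i + j = n) (el : i - 1 + j = n - 1)
    (er : i + (j - 1) = n - 1),
    cx_d tt_cx n (n - 1) ∘ tt_inj e =
    tt_inj el ∘ (cx_d X i (i - 1) ⊠ idm (Y j))
    + (tt_inj er ∘ (idm (X i) ⊠ cx_d Y j (j - 1))) *~ (-1) ^+ `|i|%N }.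

Definition graded_tensor_map (V W V' W' : int -> M)
    (G : graded_tensor V W) (G' : graded_tensor V' W')
    (f : forall n, hom (V n) (V' n)) (g : forall n, hom (W n) (W' n))
    (u : forall n, hom (G n) (G' n)) : Prop :=
  forall i j n (e : i + j = n),
    u n ∘ gt_inj G e = gt_inj G' e ∘ (f i ⊠ g j).

Definition total_tensor_map (X Y X' Y' : complex M)
    (T : total_tensor X Y) (T' : total_tensor X' Y')
    (f : chain_map X X') (g : chain_map Y Y') (t : chain_map T T') : Prop :=
  forall i j n (e : i + j = n),
    t n ∘ tt_inj T e = tt_inj T' e ∘ (f i ⊠ g j).

(* Isomorphisms H_*(X) ⊗ H_*(Y) -> H_*(X ⊗ Y), natural in X and Y, for all
   complexes for which both tensor products exist; [G] and [T] range over the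
   possible choices of these tensor products. *)
Definition kunneth : Prop :=
  exists kappa : forall (X Y : complex M) (T : total_tensor X Y)
      (G : graded_tensor (homology X) (homology Y)) n,
      hom (G n) (homology T n),
    (forall X Y T G n, is_iso (kappa X Y T G n)) /\
    (forall (X Y X' Y' : complex M)
       (T : total_tensor X Y) (T' : total_tensor X' Y')
       (G : graded_tensor (homology X) (homology Y))
       (G' : graded_tensor (homology X') (homology Y'))
       (f : chain_map X X') (g : chain_map Y Y') (t : chain_map T T')
       (u : forall n, hom (G n) (G' n)),
       total_tensor_map f g t ->
       graded_tensor_map (homology_map f) (homology_map g) u ->
       forall n, kappa X' Y' T' G' n ∘ u n =
                 homology_map t n ∘ kappa X Y T G n).

End Kunneth.

(* Main.v *)
Require Import Defs.
From mathcomp Require Import all_boot all_order all_algebra.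
From mathcomp Require Import boolp.
(* The linear algebra of mathcomp shadows [hom]. *)
Import Defs.

(** Write K for the unit object, η : K -> I for its injective resolution and λ,
    ρ for the unit isomorphisms.  The theorem is a chain-level form of the
    Eckmann-Hilton argument: both f g and g f are computed from the external
    product f ⊠ g, brought back to I by a product I ⊗ I -> I.

    Künneth makes every functor - ⊗ E exact ([tenm_exact]): an exact pair
    A -> B -> D, seen as a complex, has no homology at B, hence neither has
    its product with an object placed in degree 0.

    Exactness of the rows K ⊗ I^j -> I^0 ⊗ I^j -> I^1 ⊗ I^j -> ... and
    injectivity of the I^n then give maps Φ : I^i ⊗ I^j -> I^(i+j) satisfying
    the signed Leibniz rule and extending λ along η ⊠ 1 ([pairing_exists]).
    They are obtained one bidegree at a time, so the total complex of I ⊗ I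
    never has to be formed.

    Let f and g be cocycles of degrees p and q.  By the Leibniz rule,
    Φ (1 ⊠ g) is a chain map I ⊗ K -> I[q], while Φ (f ⊠ 1) : K ⊗ I -> I[p]
    commutes with the differentials only up to (-1)^p, hence becomes a chain
    map after multiplication by (-1)^(p n) in degree n.  Composed with the
    inverse unit isomorphisms, the first lifts g ([right_mul_lift]) and the
    second lifts a cocycle cohomologous to f ([left_mul_lift],
    [left_mul_eta]).  Composing the first with f and the second with g
    gives representatives of g f and of f g; they are Φ (f ⊠ g) and
    (-1)^(p q) Φ (f ⊠ g), both preceded by the same isomorphism K -> K ⊗ K.
    This last coincidence needs the two inverse unit isomorphisms to agree on
    K, which is arranged by correcting ρ ([unit_inverses]). *)

Set Implicit Arguments.
Unset Strict Implicit.
Unset Printing Implicit Defensive.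
Import GRing.Theory.
Local Open Scope ring_scope.
Local Open Scope cat_scope.

(** * Exactness as vanishing homology *)

Section AbelianExactness.
Variable C : abelian.
Implicit Types A B D : C.

Lemma eq_from0 A B (f g : hom A B) : idm A = 0 -> f = g.
Proof. by move=> A0; rewrite -(compm1 f) -(compm1 g) A0 !compm0. Qed.

Lemma eq_to0 A B (f g : hom A B) : idm B = 0 -> f = g.
Proof. by move=> B0; rewrite -(comp1m f) -(comp1m g) B0 !comp0m. Qed.

Lemma id0_coker_epi A B (f : hom A B) : idm (coker f) = 0 -> epi f.
Proof.
move=> Q0 W u v ufvf; apply/eqP; rewrite -subr_eq0; apply/eqP.
have uvf : (u - v) ∘ f = 0 by rewrite compBl ufvf subrr.
by rewrite -(coker_descE uvf) (eq_from0 (coker_desc uvf) 0 Q0) comp0m.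
Qed.

Lemma id0_homology (X : complex C) n : idm (X n) = 0 -> idm (homology X n) = 0.
Proof.
move=> X0; apply: (cokernel_epi (cokermP (boundaries X n))).
have K0 : idm (cycles X n) = 0.
  apply: (kernel_mono (kermP (cx_d X n (n - 1)))).
  exact: eq_to0.
exact: eq_from0.
Qed.

Section ThreeTerms.
Variables (A B D : C) (f : hom A B) (g : hom B D).

(** Exactness of A -> B -> D is the vanishing of homology in degree 0.  Defining
    objects and differentials by cases on the degrees spares any transport. *)
Definition three_obj (i : int) : C :=
  match i with Posz 1 => A | Posz 0 => B | Negz 0 => D | _ => zero_obj C end.

Definition three_d i j : hom (three_obj i) (three_obj j) :=
  match i, j return hom (three_obj i) (three_obj j) with
  | Posz 1, Posz 0 => f
  | Posz 0, Negz 0 => g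
  | _, _ => 0
  end.

Lemma three_shape i j : i != j + 1 -> three_d i j = 0.
Proof. by case: i => [[|[|i]]|[|i]] //; case: j => [[|j]|[|j]]. Qed.

Lemma three_dd (gf0 : g ∘ f = 0) i j l : three_d j l ∘ three_d i j = 0.
Proof.
case: i => [[|[|i]]|[|i]]; case: j => [[|[|j]]|[|j]];
  rewrite /= ?compm0 ?comp0m //.
by case: l => [l|[|l]] //=; rewrite ?comp0m.
Qed.

Definition three_cx gf0 : complex C := Complex three_shape (three_dd gf0).

End ThreeTerms.

(** Let b : A -> ker g be the corestriction of f.  An embedding of coker b into
    an injective object, composed with ker g -> coker b, extends to B; the
    extension kills f, hence it kills ker g, because exactness makes the
    composite of coker f with ker g zero. *)
Lemma three_homology (hI : enough_injectives C) A B D (f : hom A B) (g : hom B D)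
    (gf0 : g ∘ f = 0) :
  is_exact f g -> idm (homology (three_cx gf0) 0) = 0.
Proof.
move=> fg; apply: (cokernel_epi (cokermP _)); rewrite comp1m comp0m.
set b := boundaries _ _; have bE : kerm g ∘ b = f by exact: ker_liftE.
have [J [m [injJ mm]]] := hI (coker b).
apply: mm; rewrite compm0.
have [t tE] := injJ _ _ _ (m ∘ cokerm b) (kernel_mono (kermP g)).
have tf : t ∘ f = 0 by rewrite -bE compA tE -compA comp_cokerm compm0.
have [u [uE _]] := fg.2 _ _ (kerm_comp g).
by rewrite -tE -(coker_descE tf) -uE -compA (compA (cokerm f)) kerm_comp comp0m compm0.
Qed.
End AbelianExactness.

Lemma homology_exact (C : abelian) (X : complex C) :
  idm (homology X 0) = 0 -> is_exact (cx_d X 1 0) (cx_d X 0 (- 1)).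
Proof.
move=> /id0_coker_epi be; apply: (exact_kernel (kermP _)); first exact: cx_dd.
apply: (epiV be); rewrite -compA.
set w := kerm _ ∘ _; have -> : w = cx_d X 1 0 by exact: ker_liftE.
exact: comp_cokerm.
Qed.

(** * The Künneth formula and exactness of the tensor product *)

Section Tensor.
Variable M : monoidal.
Implicit Types A B D : M.

Lemma ten0m A A' B B' (g : hom B B') : (0 : hom A A') ⊠ g = 0.
Proof. by apply: (addrI (0 ⊠ g)); rewrite -tenmDl !addr0. Qed.

Lemma tenm0 A A' B B' (f : hom A A') : f ⊠ (0 : hom B B') = 0.
Proof. by apply: (addrI (f ⊠ 0)); rewrite -tenmDr !addr0. Qed.

Lemma tenm_compl A A' A'' B (f : hom A A') (f' : hom A' A'') :
  (f' ∘ f) ⊠ idm B = (f' ⊠ idm B) ∘ (f ⊠ idm B).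
Proof. by rewrite -tenm_comp comp1m. Qed.

Lemma tenm_compr A B B' B'' (g : hom B B') (g' : hom B' B'') :
  idm A ⊠ (g' ∘ g) = (idm A ⊠ g') ∘ (idm A ⊠ g).
Proof. by rewrite -tenm_comp comp1m. Qed.

Lemma tenm_lr A A' B B' (f : hom A A') (g : hom B B') :
  f ⊠ g = (f ⊠ idm B') ∘ (idm A ⊠ g).
Proof. by rewrite -tenm_comp comp1m compm1. Qed.

Lemma tenm_rl A A' B B' (f : hom A A') (g : hom B B') :
  f ⊠ g = (idm A' ⊠ g) ∘ (f ⊠ idm B).
Proof. by rewrite -tenm_comp comp1m compm1. Qed.

Lemma id0_tenl A B : idm A = 0 -> idm (A ⊗ B) = 0.
Proof. by move=> A0; rewrite -tenm1 A0 ten0m. Qed.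

Lemma id0_tenr A B : idm B = 0 -> idm (A ⊗ B) = 0.
Proof. by move=> B0; rewrite -tenm1 B0 tenm0. Qed.

(** Transport along an equality of degrees; degrees in [int] such as i + 0 and i
    are equal, not convertible. *)
Definition eq_hom (V : int -> M) i j (e : i = j) : hom (V i) (V j) :=
  ecast m (hom (V i) (V m)) e (idm (V i)).

Lemma conc_eq (i j n : int) : i + j = n -> j = 0 -> i = n.
Proof. by move=> <- ->; rewrite addr0. Qed.

Section Concentrated.
Variables V W : int -> M.

Definition conc_inj i j n (e : i + j = n) : hom (V i ⊗ W j) (V n ⊗ W 0) :=
  if j =P 0 is ReflectT j0 then eq_hom V (conc_eq e j0) ⊠ eq_hom W j0 else 0.

Lemma conc_inj0 n (e : n + 0 = n) : conc_inj e = idm _.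
Proof.
rewrite /conc_inj; case: eqP => // j0.
by rewrite (eq_irrelevance j0 erefl) (eq_irrelevance (conc_eq _ _) erefl) tenm1.
Qed.

Hypothesis W0 : forall j, j != 0 -> idm (W j) = 0.

(** Only the summand V n ⊗ W 0 survives in degree n, so the coproducts that
    define the tensor product exist although infinite ones need not. *)
Lemma conc_inj_coprod : is_graded_tensor conc_inj.
Proof.
move=> n Z phi; exists (phi n 0 (addr0 n)); split=> [i j e|u uE].
  have [j0|j0] := eqVneq j 0; last first.
    by apply: eq_from0; apply/id0_tenr/W0.
  have := conc_eq e j0 => ei; subst i j.
  by rewrite conc_inj0 compm1 (eq_irrelevance e (addr0 n)).
by rewrite -(uE n 0 (addr0 n)) conc_inj0 compm1.
Qed.

Definition conc_graded_tensor : graded_tensor V W := GradedTensor conc_inj_coprod.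

End Concentrated.

Definition conc_obj B (j : int) : M := if j is Posz 0 then B else zero_obj M.

Lemma conc_obj0 B j : j != 0 -> idm (conc_obj B j) = 0.
Proof. by case: j => [[|j]|j] //= _; apply: zero_initial. Qed.

Definition conc_cx B : complex M :=
  @Complex M (conc_obj B) (fun _ _ => 0) (fun _ _ _ => erefl)
    (fun _ _ _ => compm0 _ _).

Section TensorObject.
Variables (X : complex M) (B : M).

Lemma tensor_shape i j : i != j + 1 -> cx_d X i j ⊠ idm B = 0.
Proof. by move=> /cx_shape ->; rewrite ten0m. Qed.

Lemma tensor_dd i j l : (cx_d X j l ⊠ idm B) ∘ (cx_d X i j ⊠ idm B) = 0.
Proof. by rewrite -tenm_compl cx_dd ten0m. Qed.

Definition tensor_cx : complex M :=
  @Complex M (fun n => X n ⊗ B) _ tensor_shape tensor_dd.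

Lemma tensor_d i j n (e : i + j = n) (el : i - 1 + j = n - 1)
    (er : i + (j - 1) = n - 1) :
  cx_d tensor_cx n (n - 1) ∘ conc_inj X (conc_obj B) e =
  conc_inj X (conc_obj B) el ∘ (cx_d X i (i - 1) ⊠ idm (conc_obj B j))
  + (conc_inj X (conc_obj B) er
       ∘ (idm (X i) ⊠ cx_d (conc_cx B) j (j - 1))) *~ (-1) ^+ `|i|%N.
Proof.
have [j0|j0] := eqVneq j 0; last first.
  by apply: eq_from0; apply/id0_tenr/conc_obj0.
have := conc_eq e j0 => ei; subst i j.
rewrite tenm0 compm0 mul0rz addr0.
rewrite [LHS](_ : _ = cx_d X n (n - 1) ⊠ idm B); last first.
  by rewrite (conc_inj0 X (conc_obj B)) compm1.
by rewrite (conc_inj0 X (conc_obj B)) comp1m.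
Qed.

Definition tensor_total : total_tensor X (conc_cx B) :=
  @TotalTensor M X (conc_cx B) tensor_cx (conc_inj X (conc_obj B))
    (@conc_inj_coprod X (conc_obj B) (@conc_obj0 B)) tensor_d.

End TensorObject.

Hypotheses (hI : enough_injectives M) (hK : kunneth M).

(** The homology of the complex A -> B -> D tensored with E is, in degree 0,
    isomorphic to the homology of A -> B -> D tensored with E, which is zero. *)
Lemma tenm_exact A B D E (f : hom A B) (g : hom B D) :
  is_exact f g -> is_exact (f ⊠ idm E) (g ⊠ idm E).
Proof.
move=> fg; have gf0 := exact_comp fg.
pose X := three_cx gf0.
have [kappa [kI _]] := hK.
pose G := @conc_graded_tensor (homology X) (homology (conc_cx E))
  (fun j j0 => id0_homology (X := conc_cx E) (conc_obj0 E j0)).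
have [k' [_ kk']] := kI X (conc_cx E) (tensor_total X E) G 0.
apply: (@homology_exact _ (tensor_cx X E)).
apply: etrans (esym kk') _.
have G0 : idm (G 0) = 0 by apply: id0_tenl; apply: three_homology.
by rewrite (eq_to0 k' 0 G0) compm0.
Qed.

(** A monomorphism is an exact pair 0 -> A -> B. *)
Lemma tenm_mono A B E (f : hom A B) : mono f -> mono (f ⊠ idm E).
Proof.
move=> fm.
have ex0 : is_exact (0 : hom (zero_obj M) A) f.
  apply: (@exact_kernel _ _ _ _ _ (0 : hom (zero_obj M) A)).
  - split=> [|W h fh]; first exact: compm0.
    exists 0; split=> [|v _]; first by rewrite compm0 (monoV fm fh).
    by rewrite (zero_terminal v).
  - exact: compm0.
  - exact: compm0.
apply: mono0 => W x fx.
have [u [<- _]] := (tenm_exact E ex0).2 _ _ fx.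
suff -> : kerm (cokerm ((0 : hom (zero_obj M) A) ⊠ idm E)) = 0 by rewrite comp0m.
apply: (monoV _ (kerm_comp _)) => Y a b.
rewrite ten0m.
have h0 : idm (A ⊗ E) ∘ (0 : hom (zero_obj M ⊗ E) (A ⊗ E)) = 0 by rewrite compm0.
by move=> ab; rewrite -(comp1m a) -(comp1m b) -(coker_descE h0) -!compA ab.
Qed.
End Tensor.

(** * Signs, unit isomorphisms and sequences built by recursion *)

Lemma dep_choice (T : nat -> Type) (P : forall n, T n -> Prop)
    (R : forall n, T n -> T n.+1 -> Prop) :
  (exists t, P 0%N t) ->
  (forall n t, P n t -> exists t', P n.+1 t' /\ R n t t') ->
  exists t : forall n, T n, forall n, P n (t n) /\ R n (t n) (t n.+1).
Proof.
move=> /cid[t0 P0] step.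
pose next n (s : {t | P n t}) := cid (step n (sval s) (svalP s)).
pose S := fix S n : {t | P n t} :=
  if n is m.+1 then exist _ (sval (next m (S m))) (svalP (next m (S m))).1
  else exist _ t0 P0.
exists (fun n => sval (S n)) => n; split; first exact: svalP.
exact: (svalP (next n (S n))).2.
Qed.

Section Signs.
Variable C : preadditive.

Lemma comp_signl (A B D : C) (g : hom B D) (f : hom A B) n :
  (g *~ (-1) ^+ n) ∘ f = (g ∘ f) *~ (-1) ^+ n.
Proof.
by rewrite -signr_odd; case: (odd n); rewrite ?expr1 ?mulrN1z ?compNl.
Qed.

Lemma comp_signr (A B D : C) (g : hom B D) (f : hom A B) n :
  g ∘ (f *~ (-1) ^+ n) = (g ∘ f) *~ (-1) ^+ n.
Proof.
by rewrite -signr_odd; case: (odd n); rewrite ?expr1 ?mulrN1z ?compNr.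
Qed.
End Signs.

(** The inverses l' of lunit and r' of runit may differ on the unit object K, but
    only by an automorphism a := runit ∘ l' of K.  Following r' by 1 ⊠ a keeps
    it natural, and on K naturality of lunit turns (1 ⊠ a) ∘ r' into l'. *)
Lemma unit_inverses (M : monoidal) :
  exists (lam : forall X : M, hom X (unit_obj ⊗ X))
         (rho : forall X : M, hom X (X ⊗ unit_obj)),
  [/\ lunit unit_obj ∘ lam unit_obj = idm unit_obj,
      forall (X Y : M) (f : hom X Y), lam Y ∘ f = (idm unit_obj ⊠ f) ∘ lam X,
      forall (X Y : M) (f : hom X Y), rho Y ∘ f = (f ⊠ idm unit_obj) ∘ rho X
    & rho unit_obj = lam unit_obj].
Proof.
pose l' X := sval (cid (@lunit_iso M X)); pose r' X := sval (cid (@runit_iso M X)).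
have l'P X : l' X ∘ lunit X = idm _ /\ lunit X ∘ l' X = idm _ :=
  svalP (cid (lunit_iso X)).
have r'P X : r' X ∘ runit X = idm _ /\ runit X ∘ r' X = idm _ :=
  svalP (cid (runit_iso X)).
pose a := runit unit_obj ∘ l' unit_obj.
exists l', (fun X => (idm X ⊠ a) ∘ r' X); split.
- by case: (l'P unit_obj).
- move=> X Y f; rewrite -[LHS]compm1 -(l'P X).2 !compA; congr (_ ∘ _).
  by rewrite -(compA _ f) -lunit_nat compA (l'P Y).1 comp1m.
- move=> X Y f; rewrite -compA [RHS]compA -tenm_lr [f ⊠ a]tenm_rl -compA.
  congr (_ ∘ _).
  rewrite -[LHS]compm1 -(r'P X).2 !compA; congr (_ ∘ _).
  by rewrite -(compA _ f) -runit_nat compA (r'P Y).1 comp1m.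
- rewrite -[idm _ ⊠ a]comp1m -(l'P unit_obj).1 -(compA _ (lunit _)) lunit_nat.
  rewrite /a !compA -(compA _ (l' _) (lunit _)) (l'P _).1 compm1.
  by rewrite -!compA (r'P _).2 compm1.
Qed.

(** * A product on the resolution of the unit *)

(** The differential entering degree n of the augmented resolution; it makes the
    extension problems in row 0 and in the other rows the same. *)
Definition coaug_obj (C : abelian) (A : C) (I : injective_resolution A) n : C :=
  if n is m.+1 then I m else A.

Definition coaug (C : abelian) (A : C) (I : injective_resolution A) n :
    hom (coaug_obj I n) (I n) :=
  if n is m.+1 then res_d I m else res_eta I.

Lemma coaug_exact (C : abelian) (A : C) (I : injective_resolution A) n :
  is_exact (coaug I n) (res_d I n).
Proof. by case: n => [|n]; [exact: res_eta_exact | exact: res_exact]. Qed.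

Section Pairing.
Variables (M : monoidal) (hI : enough_injectives M) (hK : kunneth M).
Variables (I : injective_resolution (unit_obj : M)).
Variables (A : M) (J : injective_resolution A).

Let eta1 j := res_eta I ⊠ idm (J j).
Let dI i j := res_d I i ⊠ idm (J j).
Let dJ i j := idm (I i) ⊠ res_d J j.

Lemma dIJ i j : dI i j.+1 ∘ dJ i j = dJ i.+1 j ∘ dI i j.
Proof. by rewrite /dI /dJ -tenm_lr -tenm_rl. Qed.

Lemma dJJ i j : dJ i j.+1 ∘ dJ i j = 0.
Proof. by rewrite /dJ -tenm_compr res_dd tenm0. Qed.

Lemma eta1_dJ j : dJ 0 j ∘ eta1 j = eta1 j.+1 ∘ (idm unit_obj ⊠ res_d J j).
Proof. by rewrite /eta1 /dJ -tenm_lr -tenm_rl. Qed.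

(** Only the component j = m matters; the others are zero, so that the family is
    indexed by all j and its type involves no equation between degrees. *)
Lemma unit_extension m :
  exists x : forall j, hom (I 0%N ⊗ J j) (J m), x m ∘ eta1 m = lunit (J m).
Proof.
have etam : mono (eta1 m).
  by apply: (tenm_mono hI hK); apply: kernel_mono (res_ker I).
have [v vE] := res_inj (lunit (J m)) etam.
exists (fun j => if m =P j is ReflectT e then
  ecast n (hom (I 0%N ⊗ J n) (J m)) e v else 0).
by case: eqP => // e; rewrite (eq_irrelevance e erefl).
Qed.

(** The meaningful case is i + j = n; taking the target degree n as a separate
    index avoids transporting along equations such as i + j.+1 = (i + j).+1. *)
Definition leibniz n (phi : forall i j, hom (I i ⊗ J j) (J n))
    (psi : forall i j, hom (I i ⊗ J j) (J n.+1)) i j :=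
  res_d J n ∘ phi i j = psi i.+1 j ∘ dI i j + (psi i j.+1 ∘ dJ i j) *~ (-1) ^+ i.

(** The Leibniz rule determines psi i.+1 j on the image of d ⊠ 1 from psi i j.+1.
    Hence the column i.+1 is an extension problem along the exact row of J j;
    it can be solved when the prescribed map, called [defect], vanishes on the
    image of the previous differential of the row.  That condition for the next
    column follows from the equation just solved and the closedness of d phi. *)
Lemma pairing_step n (phi : forall i j, hom (I i ⊗ J j) (J n)) :
  phi 0%N n ∘ eta1 n = lunit (J n) ->
  (forall i j, (i + j).+1 = n -> (res_d J n ∘ phi i.+1 j) ∘ dI i j
     + ((res_d J n ∘ phi i j.+1) ∘ dJ i j) *~ (-1) ^+ i = 0) ->
  exists psi : forall i j, hom (I i ⊗ J j) (J n.+1),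
    psi 0%N n.+1 ∘ eta1 n.+1 = lunit (J n.+1) /\
    forall i j, (i + j)%N = n -> leibniz phi psi i j.
Proof.
move=> phi0 dphi.
pose T i := forall j, hom (I i ⊗ J j) (J n.+1).
pose defect i (x : T i) j :=
  res_d J n ∘ phi i j - (x j.+1 ∘ dJ i j) *~ (-1) ^+ i.
pose unital i : T i -> Prop :=
  if i is 0 return T i -> Prop
  then fun x => x n.+1 ∘ eta1 n.+1 = lunit (J n.+1) else fun=> True.
pose P i (x : T i) := unital i x /\
  forall j, (i + j)%N = n -> defect i x j ∘ (coaug I i ⊠ idm (J j)) = 0.
pose R i (x : T i) (y : T i.+1) :=
  forall j, (i + j)%N = n -> y j ∘ dI i j = defect i x j.
have [||psi psiP] := @dep_choice T P R.
- have [x xE] := unit_extension n.+1; exists x; split=> // j; rewrite add0n => ->.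
  rewrite /defect expr0 mulr1z -[coaug I 0 ⊠ _]/(eta1 n) compBl -!compA phi0.
  by rewrite eta1_dJ compA xE lunit_nat subrr.
- move=> i x [_ xP].
  have yP j : exists y : hom (I i.+1 ⊗ J j) (J n.+1),
     (i + j)%N = n -> y ∘ dI i j = defect i x j.
    have [e|ne] := eqVneq (i + j)%N n; last first.
      by exists 0 => /eqP; rewrite (negPf ne).
    have ex := tenm_exact hI hK (J j) (coaug_exact I i).
    by have [y yE] := injective_extend (@res_inj _ _ J _) ex (xP j e); exists y.
  pose y j := sval (cid (yP j)).
  have yE j : (i + j)%N = n -> y j ∘ dI i j = defect i x j := svalP (cid (yP j)).
  exists y; split=> //; split=> // j e.
  rewrite /defect -[coaug I i.+1 ⊠ _]/(dI i j) compBl comp_signl.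
  rewrite -[in X in _ - X]compA -dIJ compA yE ?addnS //.
  rewrite /defect compBl comp_signl -(compA (x j.+2)) dJJ.
  by rewrite compm0 mul0rz subr0 exprS mulN1r mulrNz opprK dphi.
exists psi; split; first by case: (psiP 0%N) => [[]].
move=> i j e; rewrite /leibniz; have [_ ->] := psiP i; last by [].
by rewrite /defect subrK.
Qed.

Lemma pairing_exists :
  exists Phi : forall n i j, hom (I i ⊗ J j) (J n),
    (forall j, Phi j 0%N j ∘ eta1 j = lunit (J j)) /\
    forall n i j, (i + j)%N = n -> leibniz (Phi n) (Phi n.+1) i j.
Proof.
pose T n := forall i j, hom (I i ⊗ J j) (J n).
pose P n (phi : T n) := phi 0%N n ∘ eta1 n = lunit (J n) /\
  forall i j, (i + j).+1 = n -> (res_d J n ∘ phi i.+1 j) ∘ dI i j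
     + ((res_d J n ∘ phi i j.+1) ∘ dJ i j) *~ (-1) ^+ i = 0.
pose R n (phi : T n) (psi : T n.+1) :=
  forall i j, (i + j)%N = n -> leibniz phi psi i j.
have [||Phi PhiP] := @dep_choice T P R.
- have [x xE] := unit_extension 0.
  by exists (fun i =>
    if i is 0 return forall j, hom (I i ⊗ J j) (J 0%N) then x else fun=> 0).
- move=> n phi [phi0 dphi]; have [psi [psi0 psiE]] := pairing_step phi0 dphi.
  exists psi; split=> //; split=> // i j [e].
  rewrite -!compA -comp_signr -compDr.
  by rewrite -(psiE _ _ e) compA res_dd comp0m.
by exists Phi; split=> [j|n]; [case: (PhiP j) => [[]] | apply: (PhiP n).2].
Qed.
End Pairing.

(** * The two multiplications *)

Lemma chain_lift_closed (C : abelian) (B D : C) (I : injective_resolution B)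
    (J : injective_resolution D) p (f : hom B (J p))
    (F : forall n, hom (I n) (J (n + p)%N)) :
  is_chain_lift f F -> res_d J p ∘ f = 0.
Proof.
by move=> [<- dF]; rewrite compA -(dF 0%N) -compA (res_ker I).1 compm0.
Qed.

(** A chain endomorphism over the identity of B is homotopic to the identity, so
    it acts trivially on cohomology.  The target degree of [R] is a separate
    index because lifts of η end in I (n + 0) rather than in I n. *)
Lemma chain_lift_eta (C : abelian) (B : C) (I : injective_resolution B) p
    (f : hom B (I p)) (R : forall n m, hom (I n) (I m)) :
  is_chain_lift (p := 0) (res_eta I) (fun n => R n (n + 0)%N) ->
  res_d I p ∘ f = 0 -> is_coboundary (R p p ∘ f - f).
Proof.
move=> [R0 dR] df0.
pose E n : hom (I n) (I (n + 0)%N) :=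
  ecast m (hom (I n) (I m)) (esym (addn0 n)) (idm _).
have EP : is_chain_lift (p := 0) (res_eta I) E.
  split=> [|n]; rewrite /E.
    by rewrite (eq_irrelevance (esym (addn0 0)) erefl) comp1m.
  have gen m (e : n = m) (e' : n.+1 = m.+1) :
      ecast k (hom (I n.+1) (I k)) e' (idm _) ∘ res_d I n =
      res_d I m ∘ ecast k (hom (I n) (I k)) e (idm _).
    by case: m / e e' => e'; rewrite (eq_irrelevance e' erefl) comp1m compm1.
  exact: gen.
have : is_coboundary ((R p (p + 0)%N - E p) ∘ f).
  apply: (chain_lift_null (F := fun n => R n (n + 0)%N - E n) (f := 0)) df0.
    split=> [|n]; first by rewrite compBl R0 EP.1 subrr.
    by rewrite compBl dR EP.2 compBr.
  by [].
rewrite /E; move: (p + 0)%N (esym (addn0 p)) => m e; case: m / e.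
by rewrite compBl comp1m.
Qed.

Section Commutation.
Variables (M : monoidal).
Let K : M := unit_obj.
Variables (I : injective_resolution K).
Variable Phi : forall n i j, hom (I i ⊗ I j) (I n).
Hypothesis Phi_unit : forall j, Phi j 0%N j ∘ (res_eta I ⊠ idm (I j)) = lunit (I j).
Hypothesis Phi_d : forall n i j, (i + j)%N = n -> leibniz (Phi n) (Phi n.+1) i j.
Variables (lam : forall X : M, hom X (K ⊗ X)) (rho : forall X : M, hom X (X ⊗ K)).
Hypothesis lamK : lunit K ∘ lam K = idm K.
Hypothesis lam_nat : forall (X Y : M) (f : hom X Y),
  lam Y ∘ f = (idm K ⊠ f) ∘ lam X.
Hypothesis rho_nat : forall (X Y : M) (f : hom X Y),
  rho Y ∘ f = (f ⊠ idm K) ∘ rho X.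
Hypothesis rhoK : rho K = lam K.

Definition right_mul q (g : hom K (I q)) n m : hom (I n) (I m) :=
  Phi m n q ∘ (idm (I n) ⊠ g) ∘ rho (I n).

Definition left_mul p (f : hom K (I p)) n m : hom (I n) (I m) :=
  Phi m p n ∘ (f ⊠ idm (I n)) ∘ lam (I n).

Lemma right_mulE p q (f : hom K (I p)) (g : hom K (I q)) n :
  right_mul g p n ∘ f = Phi n p q ∘ (f ⊠ g) ∘ lam K.
Proof.
by rewrite /right_mul -compA rho_nat rhoK !compA -(compA (Phi _ _ _)) -tenm_rl.
Qed.

Lemma left_mulE p q (f : hom K (I p)) (g : hom K (I q)) n :
  left_mul f q n ∘ g = Phi n p q ∘ (f ⊠ g) ∘ lam K.
Proof.
by rewrite /left_mul -compA lam_nat !compA -(compA (Phi _ _ _)) -tenm_lr.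
Qed.

Lemma right_mul_lift q (g : hom K (I q)) : res_d I q ∘ g = 0 ->
  is_chain_lift g (fun n => right_mul g n (n + q)%N).
Proof.
move=> dg0; split=> [|n].
  by rewrite right_mulE tenm_lr compA Phi_unit lunit_nat -compA lamK compm1.
rewrite /right_mul -compA rho_nat !compA Phi_d // compDl comp_signl.
rewrite -(compA (Phi _ n q.+1)) -tenm_compr dg0 tenm0 compm0 mul0rz addr0.
by congr (_ ∘ _); rewrite -!compA -tenm_rl -tenm_lr.
Qed.

(** The differential passes f at the cost of (-1)^p, so the n-th component, which
    it meets n times, needs the sign (-1)^(p n). *)
Lemma left_mul_lift p (f : hom K (I p)) : res_d I p ∘ f = 0 ->
  is_chain_lift (left_mul f 0 p ∘ res_eta I)
    (fun n => left_mul f n (n + p)%N *~ (-1) ^+ (p * n)).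
Proof.
move=> df0; split=> [|n]; first by rewrite muln0 mulr1z.
rewrite comp_signl comp_signr mulnS exprD mulrzA; congr (_ *~ _).
rewrite /left_mul -compA lam_nat !compA (Phi_d (addnC p n)) compDl.
rewrite -(compA (Phi _ p.+1 n)) -tenm_compl df0 ten0m compm0 add0r.
rewrite !comp_signl; congr (_ *~ _).
by congr (_ ∘ _); rewrite -!compA -tenm_rl -tenm_lr.
Qed.

(** Both sides are read off the product f ⊠ η: multiplying η by f on the left is
    multiplying f by η on the right, and the latter lifts the identity. *)
Lemma left_mul_eta p (f : hom K (I p)) : res_d I p ∘ f = 0 ->
  is_coboundary (left_mul f 0 p ∘ res_eta I - f).
Proof.
move=> df0; rewrite left_mulE -right_mulE; apply: chain_lift_eta df0.
by apply: right_mul_lift; case: (res_ker I).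
Qed.

End Commutation.

Lemma class_mulz (C : abelian) (A B : C) (J : injective_resolution B) n
    (x : cocycle A J n) z : class (x *~ z) = class x *~ z.
Proof. exact: (raddfMz (\pi_(Hn A J n))%qT). Qed.

(** * Graded commutativity *)

Theorem theorem1p3 (M : braided) (hI : enough_injectives M) (hK : kunneth M)
    (p q : nat) (f : Ext hI p (unit_obj : M) (unit_obj : M))
    (g : Ext hI q (unit_obj : M) (unit_obj : M)) :
  yoneda f g = ext_cast (addnC q p) (yoneda g f *~ (-1) ^+ (p * q)).
Proof.
set K : M := unit_obj; pose I := injres hI K.
have [Phi [Phi_unit Phi_d]] := pairing_exists hI hK I I.
have [lam [rho [lamK lam_nat rho_nat rhoK]]] := unit_inverses M.
have cE n (x : Ext hI n K K) : class (repr x : cocycle K I n) = x by exact: reprK.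
rewrite -(cE _ f) -(cE _ g).
move: (repr f : cocycle K I p) (repr g : cocycle K I q) => a b {f g}.
have Ra := right_mul_lift Phi_unit Phi_d lamK rho_nat rhoK (cocycleP b).
have La := left_mul_lift Phi_d lam_nat (cocycleP a).
rewrite (yoneda_class a Ra).
(* f is traded for the cohomologous cocycle of which left_mul a is a lift. *)
have -> : class a = class (mk_cocycle (chain_lift_closed La)).
  by apply/esym/class_eq; apply: left_mul_eta (cocycleP a).
rewrite (yoneda_class (f := mk_cocycle (chain_lift_closed La)) b La).
congr (ext_cast _ _).
set x := mk_cocycle _; set y := mk_cocycle _.
pose ab n := Phi n p q ∘ (cocycle_val a ⊠ cocycle_val b) ∘ lam K.
have xE : cocycle_val x = ab (q + p)%N *~ (-1) ^+ (p * q).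
  by rewrite /= comp_signl (left_mulE Phi lam_nat).
have yE : cocycle_val y = ab (p + q)%N.
  by rewrite /= (right_mulE Phi rho_nat rhoK).
move: x y xE yE; move: (p + q)%N (q + p)%N (addnC p q) => m n e.
case: n / e => x y xE yE; rewrite -class_mulz; congr class.
by apply: val_inj; rewrite /= xE -yE [RHS](raddfMz val).
Qed.
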